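(* Given a path $Q$ and an event $a\in Q$, there is (i) an event $b\in Q$ with $b$ distinct from $a$, and (ii) an event $c\notin Q$ and a path $ac$ containing both $a$ and $c$ (distinct from $Q$).
   Context: Let $\mathcal E$ be a set, whose elements are called events; let $\mathcal P$ be a set of subsets of $\mathcal E$, whose elements are called paths; and let $[\,\cdot\;\cdot\;\cdot\,]$ be a ternary relation (betweenness) on $\mathcal E$. Definitions. A finite chain is a sequence $(q_0,\dots,q_n)$ of events, $n\ge1$, such that: if $n=1$, then $q_0\ne q_1$ and some path contains both; if $n\ge2$, then $[q_i\;q_j\;q_k]$ for all $0\le i<j<k\le n$. An infinite chain is a sequence $(q_i)_{i\in\mathbb N}$ of events with $[q_i\;q_j\;q_k]$ for all $i<j<k$. A bound of an infinite chain is an event $q$ with $[q_i\;q_j\;q]$ for all $i<j$; a closest bound is a bound $q$ such that $[q_0\;q\;q']$ for every bound $q'\ne q$. For a path $Q$ and an event $b\notin Q$, the unreachable subset of $Q$ from $b$ is $Q(b,\emptyset)=\{x\in Q:\text{ no path contains both } b \text{ and } x\}$. For distinct paths $Q,R$ meeting at $x$ and $Q_a\in Q$, $Q(Q_a,R,x,\emptyset)=\{y: [x\;y\;Q_a]\text{ and there is } w\in R \text{ (}w\notin Q\text{) with } Q_a,y\in Q(w,\emptyset)\}$. $\mathrm{SPRAY}[x]$ is the set of paths containing the event $x$. Three distinct paths of $\mathrm{SPRAY}[x]$ are dependent if some path not in $\mathrm{SPRAY}[x]$ meets each of the three; then each is said to be dependent on the set of the other two. Inductively, a path $T$ is dependent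 on a set $S\subseteq\mathrm{SPRAY}[x]$ with $n\ge3$ elements if $T$ is dependent on a set of two paths $\{S_1,S_2\}$, each of which is dependent on some subset of $S$ with $n-1$ elements. A set of paths is dependent if it contains a path $P$ and a subset not containing $P$ on which $P$ is dependent (for some $x$); it is independent if it has no dependent subset. $\mathrm{SPRAY}[x]$ is a 3-SPRAY if it contains four distinct paths forming an independent set such that every path of $\mathrm{SPRAY}[x]$ is dependent on the set of these four. The following axioms are assumed. (I1) $\mathcal E\neq\emptyset$. (I2) For distinct events $a,b$ there are paths $R\ni a$, $S\ni b$ with $R\cap S\ne\emptyset$. (I3) For any two distinct events there is at most one path containing both. (I4) If $\mathcal E\ne\emptyset$, there is at least one 3-SPRAY. (O1) If $[a\;b\;c]$ then some path contains $a,b,c$. (O2) $[a\;b\;c]\Rightarrow[c\;b\;a]$. (O3) $[a\;b\;c]\Rightarrow a\neq c$. (O4) $[a\;b\;c]$ and $[b\;c\;d]$ imply $[a\;b\;d]$ (no distinctness of $a,d$ is assumed). (O5) If $a,b,c$ are distinct events of one path, then $[a\;b\;c]$ or $[b\;c\;a]$ or $[c\;a\;b]$. (O6) If $Q,R,S$ are distinct paths, $T$ is a path, $a\in Q\cap R$, $b\in Q\cap S$, $c\in R\cap S$, and there are $d\in S$ with $[b\;c\;d]$ and $e\in R$ with $[c\;e\;a]$ and $d,e\in T$, then there is $f\in T\cap Q$ belonging to a finite chain with first event $a$ and last event $b$, where $a,f,b$ are distinct. (I5) For any path $Q$ and event $b\notin Q$, the set $Q(b,\emptyset)$ contains at least two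 events. (I6) For any path $Q$, event $b\notin Q$ and distinct $Q_x,Q_z\in Q(b,\emptyset)$ there is a finite chain $(q_0,\dots,q_n)$ with $q_0=Q_x$, $q_n=Q_z$ such that for all $i\in\{1,\dots,n\}$: $q_i\in Q(b,\emptyset)$, and every event $y$ with $[q_{i-1}\;y\;q_i]$ lies in $Q(b,\emptyset)$. (I7) For any path $Q$, event $b\notin Q$, $Q_x\in Q\setminus Q(b,\emptyset)$ and $Q_y\in Q(b,\emptyset)$ there is a finite chain $(q_0,\dots,q_n)$ and $0<m<n$ with $q_0=Q_x$, $q_m=Q_y$ and $q_n\in Q\setminus Q(b,\emptyset)$. (S) If $Q,R,S$ are distinct paths with $x\in Q\cap R\cap S$, and $Q_a\in Q\setminus\{x\}$ satisfies $Q(Q_a,R,x,\emptyset)=Q(Q_a,S,x,\emptyset)$, then there is a map $\theta:\mathcal E\to\mathcal E$ such that $P\mapsto\theta(P)$ (direct image) is a bijection $\mathcal P\to\mathcal P$, $\theta(y)=y$ for all $y\in Q$, and $\theta(R)=S$. (C) Every infinite chain that has a bound has a closest bound. *)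

(* Defs.v *)
From mathcomp Require Import all_boot.
From mathcomp Require Import boolp classical_sets functions cardinality.

Set Implicit Arguments.
Unset Strict Implicit.
Unset Printing Implicit Defensive.

Local Open Scope classical_set_scope.
Local Open Scope card_scope.

(* Throughout, [E] is the set of events, [paths] the set of paths, and
   [btw a b c] the betweenness relation usually written [a b c] in brackets. *)

(* The finite sequence (q 0, ..., q n) is the restriction of q : nat -> E to the
   indices at most n; the values of q beyond n are irrelevant. *)
Definition finite_chain (E : Type) (paths : set (set E)) (btw : E -> E -> E -> Prop)
    (q : nat -> E) (n : nat) : Prop :=
  [/\ 1 <= n,
      n = 1 -> q 0 <> q 1 /\ (exists Q, [/\ paths Q, Q (q 0) & Q (q 1)])
    & 2 <= n -> forall i j k : nat, i < j -> j < k -> k <= n ->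
        btw (q i) (q j) (q k)].

Definition infinite_chain (E : Type) (btw : E -> E -> E -> Prop)
    (q : nat -> E) : Prop :=
  forall i j k : nat, i < j -> j < k -> btw (q i) (q j) (q k).

Definition chain_bound (E : Type) (btw : E -> E -> E -> Prop)
    (q : nat -> E) (b : E) : Prop :=
  forall i j : nat, i < j -> btw (q i) (q j) b.

Definition closest_bound (E : Type) (btw : E -> E -> E -> Prop)
    (q : nat -> E) (b : E) : Prop :=
  chain_bound btw q b /\
  (forall b', chain_bound btw q b' -> b' <> b -> btw (q 0) b b').

Definition unreachable (E : Type) (paths : set (set E)) (Q : set E) (b : E) : set E :=
  [set x | Q x /\ ~ (exists R, [/\ paths R, R b & R x])].

(* The set Q(Qa, R, x, emptyset), of events of Q unreachable from Qa via R. *)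
Definition unreachable_via (E : Type) (paths : set (set E)) (btw : E -> E -> E -> Prop)
    (Q : set E) (Qa : E) (R : set E) (x : E) : set E :=
  [set y | btw x y Qa /\
    (exists w, [/\ R w, ~ Q w, unreachable paths Q w Qa & unreachable paths Q w y])].

Definition spray (E : Type) (paths : set (set E)) (x : E) : set (set E) :=
  [set R | paths R /\ R x].

(* Dependence of three distinct paths of SPRAY[x]; symmetric in Q, R, S. *)
Definition dependent3 (E : Type) (paths : set (set E)) (x : E) (Q R S : set E) : Prop :=
  [/\ spray paths x Q /\ spray paths x R /\ spray paths x S,
      Q <> R /\ R <> S /\ S <> Q
    & exists T, [/\ paths T, ~ spray paths x T
        & T `&` Q !=set0 /\ T `&` R !=set0 /\ T `&` S !=set0]].

(* [dependent_on paths x T S]: the path T is dependent on the set S of paths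
   of SPRAY[x]. *)
Inductive dependent_on (E : Type) (paths : set (set E)) (x : E) :
    set E -> set (set E) -> Prop :=
| dependent_on_pair (T S1 S2 : set E) :
    dependent3 paths x T S1 S2 -> dependent_on paths x T [set S1; S2]
| dependent_on_step (n : nat) (T : set E) (S : set (set E))
    (S1 S2 : set E) (A1 A2 : set (set E)) :
    3 <= n -> S `<=` spray paths x -> S #= `I_n ->
    dependent3 paths x T S1 S2 ->
    A1 `<=` S -> A1 #= `I_(n.-1) -> dependent_on paths x S1 A1 ->
    A2 `<=` S -> A2 #= `I_(n.-1) -> dependent_on paths x S2 A2 ->
    dependent_on paths x T S.

Definition dependent_set (E : Type) (paths : set (set E)) (D : set (set E)) : Prop :=
  exists (x : E) (P : set E) (S : set (set E)),
    [/\ D P, S `<=` D, ~ S P & dependent_on paths x P S].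

Definition independent_set (E : Type) (paths : set (set E)) (D : set (set E)) : Prop :=
  forall D', D' `<=` D -> ~ dependent_set paths D'.

Definition three_spray (E : Type) (paths : set (set E)) (x : E) : Prop :=
  exists F : set (set E),
    [/\ F `<=` spray paths x, F #= `I_4, independent_set paths F
      & forall T, spray paths x T -> dependent_on paths x T F].

(* Schutz's independent axiom system for Minkowski space-time. *)
Record minkowski_axioms (E : Type) (paths : set (set E))
    (btw : E -> E -> E -> Prop) : Prop := MinkowskiAxioms {
  axI1_existence : [set: E] !=set0 ;
  axI2_connectedness : forall a b : E, a <> b ->
    exists R S, [/\ paths R, paths S, R a, S b & R `&` S !=set0] ;
  axI3_uniqueness : forall a b : E, a <> b ->
    forall Q R, paths Q -> paths R -> Q a -> Q b -> R a -> R b -> Q = R ;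
  axI4_dimension : [set: E] !=set0 -> exists x, three_spray paths x ;
  axO1 : forall a b c, btw a b c -> exists Q, [/\ paths Q, Q a, Q b & Q c] ;
  axO2 : forall a b c, btw a b c -> btw c b a ;
  axO3 : forall a b c, btw a b c -> a <> c ;
  axO4 : forall a b c d, btw a b c -> btw b c d -> btw a b d ;
  axO5 : forall Q a b c, paths Q -> Q a -> Q b -> Q c ->
    a <> b -> b <> c -> c <> a -> btw a b c \/ btw b c a \/ btw c a b ;
  axO6_collinearity : forall (Q R S T : set E) (a b c d e : E),
    paths Q -> paths R -> paths S -> paths T ->
    Q <> R -> R <> S -> S <> Q ->
    (Q `&` R) a -> (Q `&` S) b -> (R `&` S) c ->
    S d -> btw b c d -> R e -> btw c e a -> T d -> T e ->
    exists f, [/\ (T `&` Q) f,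
      exists (q : nat -> E) (n i : nat),
        [/\ finite_chain paths btw q n, q 0 = a, q n = b, i <= n & q i = f]
      & a <> f /\ f <> b /\ a <> b] ;
  axI5_nongalilean : forall Q b, paths Q -> ~ Q b ->
    exists y z, [/\ unreachable paths Q b y, unreachable paths Q b z & y <> z] ;
  axI6_unreachable_connected : forall Q b Qx Qz, paths Q -> ~ Q b ->
    unreachable paths Q b Qx -> unreachable paths Q b Qz -> Qx <> Qz ->
    exists (q : nat -> E) (n : nat),
      [/\ finite_chain paths btw q n, q 0 = Qx, q n = Qz
        & forall i : nat, 1 <= i -> i <= n ->
            unreachable paths Q b (q i) /\
            (forall y, btw (q i.-1) y (q i) -> unreachable paths Q b y)] ;
  axI7_unreachable_bounded : forall Q b Qx Qy, paths Q -> ~ Q b ->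
    (Q `\` unreachable paths Q b) Qx -> unreachable paths Q b Qy ->
    exists (q : nat -> E) (m n : nat),
      [/\ finite_chain paths btw q n, 0 < m /\ m < n, q 0 = Qx, q m = Qy
        & (Q `\` unreachable paths Q b) (q n)] ;
  axS_symmetry : forall (Q R S : set E) (x Qa : E),
    paths Q -> paths R -> paths S -> Q <> R -> R <> S -> S <> Q ->
    Q x -> R x -> S x -> Q Qa -> Qa <> x ->
    unreachable_via paths btw Q Qa R x = unreachable_via paths btw Q Qa S x ->
    exists theta : E -> E,
      [/\ set_bij paths paths (fun P => theta @` P),
          forall y, Q y -> theta y = y
        & theta @` R = S] ;
  axC_continuity : forall q : nat -> E, infinite_chain btw q ->
    (exists b, chain_bound btw q b) -> exists b, closest_bound btw q b
}.

(* Main.v *)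
Require Import Defs.
From mathcomp Require Import all_boot.
From mathcomp Require Import boolp classical_sets functions cardinality.

(* A 3-SPRAY contains three distinct paths through one event met by a further
    path not through it, so no path exhausts the events, and (I5) yields at
    least two events on every path. For the second part, join [a] to an event
    off [Q] by (I2). The only difficult case is a path [S] meeting [Q] at [f],
    with [a] not on [S]: were [Q] the only path through [a], every event of [S]
    but [f] would be unreachable from [a], whereas (I7) provides reachable
    events of [S] on both sides of an unreachable one. *)

Set Implicit Arguments.
Unset Strict Implicit.
Unset Printing Implicit Defensive.

Local Open Scope classical_set_scope.

Lemma dependent_on_dependent3 (E : Type) (paths : set (set E)) (x : E)
    (T : set E) (F : set (set E)) :
  dependent_on paths x T F -> exists S1 S2, dependent3 paths x T S1 S2.
Proof.
by case=> [T' S1 S2 | n T' F' S1 S2 A1 A2 _ _ _] T_dep *; exists S1, S2.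
Qed.

Section Events.

Variables (E : Type) (paths : set (set E)) (btw : E -> E -> E -> Prop).
Hypothesis ax : minkowski_axioms paths btw.

Lemma exists_notin_path (Q : set E) : paths Q -> exists e, ~ Q e.
Proof.
move=> pQ; apply: contrapT => /forallNP allQ.
have {}allQ e : Q e by exact: contrapT (allQ e).
have [x [F [Fx F4 _ Fdep]]] := axI4_dimension ax (axI1_existence ax).
have [T FT] : F !=set0.
  apply/set0P/eqP => F0; move: F4; rewrite F0 card_eq_sym card_eq0.
  by move=> /eqP/seteqP[/(_ 0)/(_ isT)].
have [S1 [S2 []]] := dependent_on_dependent3 (Fdep T (Fx T FT)).
move=> [[pT Tx] [[pS1 S1x] _]] [TS1 _] [U [pU Ux]].
move=> [[y [Uy Ty]] [[z [Uz S1z]] _]].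
have xNU w : U w -> x <> w by move=> Uw xw; apply: Ux; rewrite /spray /= xw.
(* [U] avoids [x], so it meets [T] and [S1] away from [x]; if [Q] held every event, it would share
   two events with each of them. *)
apply: TS1; transitivity Q.
  exact: (axI3_uniqueness ax (xNU y Uy)).
exact: (axI3_uniqueness ax (xNU z Uz)).
Qed.

Lemma exists_other_event (Q : set E) (a : E) :
  paths Q -> exists b, Q b /\ b <> a.
Proof.
move=> pQ; have [e Qe] := exists_notin_path pQ.
have [y [z [[Qy _] [Qz _] yz]]] := axI5_nongalilean ax pQ Qe.
have [ya|ya] := pselect (y = a); last by exists y.
by exists z; split=> // za; apply: yz; rewrite ya za.
Qed.

(** The chain that (I7) leads from [f] through an unreachable event ends at a joined event, which
    (O3) separates from [f]. *)
Lemma exists_other_joined_event (S : set E) (a f : E) :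
  paths S -> ~ S a ->
  (S `\` unreachable paths S a) f ->
  exists g, g <> f /\ (S `\` unreachable paths S a) g.
Proof.
move=> pS Sa Sf.
have [y [_ [uy _ _]]] := axI5_nongalilean ax pS Sa.
have [q [m [n [[_ _ qbtw] [m0 mn] q0 _ Sqn]]]] :=
  axI7_unreachable_bounded ax pS Sa Sf uy.
exists (q n); split=> //; rewrite -q0; apply: nesym.
have n2 : 2 <= n by exact: leq_ltn_trans m0 mn.
exact: axO3 ax _ _ _ (qbtw n2 0 m n m0 mn (leqnn n)).
Qed.

Lemma exists_other_path (Q : set E) (a : E) :
  paths Q -> Q a -> exists R, [/\ paths R, R a & R <> Q].
Proof.
move=> pQ Qa; have [e Qe] := exists_notin_path pQ.
have ae : a <> e by move=> ae; apply: Qe; rewrite -ae.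
have [R [S [pR pS Ra Se [f [Rf Sf]]]]] := axI2_connectedness ax ae.
have [RQ|] := pselect (R = Q); last by exists R.
have SQ : S <> Q by move=> SQ; apply: Qe; rewrite -SQ.
have [Sa|Sa] := pselect (S a); first by exists S.
have [|g [gf [Sg ug]]] := @exists_other_joined_event S a f pS Sa.
  (* [R] itself joins [a] to [f]. *)
  by split=> // -[_]; apply; exists R.
have [P [pP Pa Pg]] : exists P, [/\ paths P, P a & P g].
  by apply: contrapT => nP; apply: ug.
(* If [P] were [Q], then [Q], which is also [R], would share both [f] and [g] with [S]. *)
exists P; split=> // PQ; apply: SQ.
by apply: (axI3_uniqueness ax gf) => //; rewrite -?PQ -?RQ // PQ -RQ.
Qed.

End Events.

Theorem theorem5 (E : Type) (paths : set (set E)) (btw : E -> E -> E -> Prop)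
    (ax : minkowski_axioms paths btw) (Q : set E) (a : E)
    (HQ : paths Q) (Ha : Q a) :
  (exists b : E, Q b /\ b <> a) /\
  (exists (c : E) (R : set E), [/\ ~ Q c, paths R, R a, R c & R <> Q]).
Proof.
split; first exact: (exists_other_event ax).
have [R [pR Ra RQ]] := exists_other_path ax HQ Ha.
have [c [Rc ca]] := exists_other_event ax a pR.
(* With [c] on [Q], the paths [R] and [Q] would share [a] and [c]. *)
exists c, R; split=> // Qc; apply: RQ.
exact: (axI3_uniqueness ax ca).
Qed.
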